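(* Let $\Sigma$ be a signature, $\mathbf{K}$ a quasivariety of $\Sigma$-structures and $X$ a set of variables. If $(Co_{\mathbf{K}},i)$ is a filter pair such that $i_{Fm(X)}:Co_{\mathbf{K}}(Fm(X))\to\mathcal{P}(Fm(X))$ is injective, then the associated logic $(\Sigma,\vdash^X)$ is algebraizable.
   Context: $\Sigma$-Str is the category of $\Sigma$-structures and homomorphisms; $Fm(X)$ is the absolutely free $\Sigma$-structure on $X$. $AL$ is the category of algebraic lattices with maps preserving arbitrary meets and directed joins. A filter pair over $\Sigma$ is a pair $(G,i)$ of a contravariant functor $G:\Sigma\text{-Str}\to AL$ and maps $i_A:G(A)\to(\mathcal{P}(A),\subseteq)$, one for each $\Sigma$-structure $A$, preserving arbitrary infima (in particular $i_A(\top)=A$) and directed suprema, and such that $i_A\circ G(h)=h^{-1}\circ i_B$ for every homomorphism $h:A\to B$. The associated logic $(\Sigma,\vdash^X)$: for $\Gamma\cup\{\varphi\}\subseteq Fm(X)$, $\Gamma\vdash^X\varphi$ iff for every $a\in G(Fm(X))$, $\Gamma\subseteq i_{Fm(X)}(a)$ implies $\varphi\in i_{Fm(X)}(a)$. For a quasivariety $\mathbf{K}$ (a class axiomatizable by quasi-identities), $Co_{\mathbf{K}}(A)$ is the lattice of congruences $\theta$ on $A$ with $A/\theta\in\mathbf{K}$, ordered by inclusion, and $Co_{\mathbf{K}}(f)=(f\times f)^{-1}$ on homomorphisms; this is a contravariant functor to $AL$. A logic $l=(\Sigma,\vdash_l)$ is algebraizable (Blok–Pigozzi) if there are a class $\mathbf{K}'$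 of $\Sigma$-structures, a set $\tau$ of equations $\delta(x)\approx\epsilon(x)$ in one variable and a finite set $\Delta(p,q)$ of formulas in two variables such that (1) $\Gamma\vdash_l\varphi$ iff $\{\delta(\gamma)\approx\epsilon(\gamma)\mid\gamma\in\Gamma,\,\delta\approx\epsilon\in\tau\}\models_{\mathbf{K}'}\delta(\varphi)\approx\epsilon(\varphi)$ for all $\delta\approx\epsilon\in\tau$; (2) for every set $\Gamma$ of equations and equation $\varphi\approx\psi$, $\Gamma\models_{\mathbf{K}'}\varphi\approx\psi$ iff $\bigcup\{\Delta(\xi,\eta)\mid\xi\approx\eta\in\Gamma\}\vdash_l\Delta(\varphi,\psi)$; (3) for every formula $\psi$, $\psi$ and $\bigcup\{\Delta(\delta(\psi),\epsilon(\psi))\mid\delta\approx\epsilon\in\tau\}$ are interderivable in $l$. Here $\Gamma\models_{\mathbf{K}'}\varphi\approx\psi$ means that for every $A\in\mathbf{K}'$ and homomorphism $h:Fm(X)\to A$ identifying both sides of every equation in $\Gamma$, $h(\varphi)=h(\psi)$.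
   Formalization: The set X of variables is assumed to have at least two distinct elements; for fewer the claim fails, e.g. |X| = 1, one constant c, K all structures, i_A(θ) = {a : a θ c}. *)

(* Defs.v *)
From HB Require Import structures.
From mathcomp Require Import all_boot all_order.
From mathcomp Require Import boolp classical_sets functions cardinality.

Set Implicit Arguments.
Unset Strict Implicit.
Unset Printing Implicit Defensive.

Import Order.TTheory.
Local Open Scope classical_set_scope.

Section OrderNotions.
Context {d : Order.disp_t} {L : porderType d}.
Implicit Types (D S : set L) (x y c : L).

Definition directed D :=
  D !=set0 /\
  forall x y, D x -> D y -> exists z, [/\ D z, (x <= z)%O & (y <= z)%O].

Definition compact_elt c :=
  forall D s, directed D -> supremums D s -> (c <= s)%O ->
    exists2 x, D x & (c <= x)%O.

End OrderNotions.

HB.mixin Record isAlgebraicLattice d (L : Type) of Order.POrder d L := {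
  has_infimums : forall S : set L, infimums S !=set0;
  has_supremums : forall S : set L, supremums S !=set0;
  compactly_generated : forall x : L,
    supremums [set c | compact_elt c /\ (c <= x)%O] x }.

#[short(type="algLatticeType")]
HB.structure Definition AlgLattice d :=
  { L of isAlgebraicLattice d L & Order.POrder d L }.

Section Preservation.
Context {d d' : Order.disp_t} {L : porderType d} {M : porderType d'}.

(* With [S := set0] this says that the top element is preserved. *)
Definition preserves_infima (f : L -> M) :=
  forall (S : set L) m, infimums S m -> infimums (f @` S) (f m).

Definition preserves_directed_suprema (f : L -> M) :=
  forall (D : set L) s, directed D -> supremums D s -> supremums (f @` D) (f s).

End Preservation.

Record signature := Signature { operation :> Type; arity : operation -> nat }.

Section Structures.
Variable Sigma : signature.

Record structure := Structure {
  carrier :> Type;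
  interp : forall f : Sigma, ('I_(arity f) -> carrier) -> carrier }.

Record hom (A B : structure) := Hom {
  hom_fun :> A -> B;
  homP : forall (f : Sigma) (a : 'I_(arity f) -> A),
    hom_fun (interp a) = interp (fun j => hom_fun (a j)) }.

Definition hom_id (A : structure) : hom A A :=
  @Hom A A (fun a => a) (fun _ _ => erefl).

Lemma hom_comp_subproof A B C (g : hom B C) (h : hom A B) (f : Sigma)
    (a : 'I_(arity f) -> A) :
  g (h (interp a)) = interp (fun j => g (h (a j))).
Proof. by rewrite !homP. Qed.

Definition hom_comp A B C (g : hom B C) (h : hom A B) : hom A C :=
  @Hom A C (fun a => g (h a)) (hom_comp_subproof g h).

Inductive Fm (X : Type) : Type :=
| Var of X
| App (f : Sigma) of ('I_(arity f) -> Fm X).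

Definition FmS (X : Type) : structure := @Structure (Fm X) (@App X).

Fixpoint eval (X : Type) (A : structure) (v : X -> A) (t : Fm X) : A :=
  match t with
  | Var x => v x
  | App f a => interp (fun j => eval v (a j))
  end.

Definition subst (X Y : Type) (v : X -> Fm Y) : Fm X -> Fm Y :=
  @eval X (FmS Y) v.

Definition eval_hom X (A : structure) (v : X -> A) : hom (FmS X) A :=
  @Hom (FmS X) A (eval v) (fun _ _ => erefl).

Lemma hom_FmE X (A : structure) (h : hom (FmS X) A) t :
  h t = eval (fun x => h (Var x)) t.
Proof.
elim: t => [//|f a IH] /=; rewrite -[App a]/(@interp (FmS X) f a) homP.
by congr interp; apply/funext => j; rewrite IH.
Qed.

Definition equation (X : Type) := (Fm X * Fm X)%type.

Definition solves X (A : structure) (h : hom (FmS X) A) (e : equation X) :=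
  h e.1 = h e.2.

Definition models (K : structure -> Prop) X (E : set (equation X))
    (e : equation X) :=
  forall A, K A -> forall h : hom (FmS X) A,
    (forall e', E e' -> solves h e') -> solves h e.

Record quasi_identity := QuasiIdentity {
  premises : set (equation nat);
  premises_finite : finite_set premises;
  conclusion : equation nat }.

Definition satisfies (A : structure) (q : quasi_identity) :=
  forall h : hom (FmS nat) A,
    (forall e, premises q e -> solves h e) -> solves h (conclusion q).

Record quasivariety := Quasivariety {
  in_qv :> structure -> Prop;
  qv_axiomatizable : exists Q : set quasi_identity,
    forall A, in_qv A <-> (forall q, Q q -> satisfies A q) }.

Definition congruence (A : structure) (theta : set (A * A)) :=
  [/\ forall a, theta (a, a),
      forall a b, theta (a, b) -> theta (b, a),
      forall a b c, theta (a, b) -> theta (b, c) -> theta (a, c)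
    & forall (f : Sigma) (a b : 'I_(arity f) -> A),
        (forall j, theta (a j, b j)) -> theta (interp a, interp b)].

Section Quotient.
Variables (A : structure) (theta : set (A * A)).

Definition eqclass (a : A) : set A := [set b | theta (a, b)].

Definition quot_carrier := {C : set A | exists a, C = eqclass a}.

Definition quot_pi (a : A) : quot_carrier :=
  exist _ (eqclass a) (ex_intro _ a erefl).

Definition quot_repr (C : quot_carrier) : A := projT1 (cid (projT2 C)).

(* The operations act on chosen representatives; when [theta] is a congruence
   the choice is immaterial, as [quot_pi_hom] shows. *)
Definition quotient : structure :=
  @Structure quot_carrier
    (fun f c => quot_pi (interp (fun j => quot_repr (c j)))).

Lemma quot_reprK C : quot_pi (quot_repr C) = C.
Proof.
case: C => C hC; apply: eq_exist => /=.
by rewrite /quot_repr /=; case: cid => a /= ->.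
Qed.

Hypothesis thetaP : congruence theta.

Lemma quot_piE a b : quot_pi a = quot_pi b <-> theta (a, b).
Proof.
case: thetaP => rfl sym trans _; split => [/(congr1 (@proj1_sig _ _)) /= ab|ab].
  have : eqclass b b by exact: rfl.
  by rewrite -ab.
apply: eq_exist; apply/seteqP; split => c /=.
- by apply: trans; exact: sym.
- exact: trans.
Qed.

Lemma quot_pi_hom (f : Sigma) (a : 'I_(arity f) -> A) :
  quot_pi (interp a) = @interp quotient f (fun j => quot_pi (a j)).
Proof.
apply/quot_piE; case: thetaP => _ _ _; apply => j.
by apply/quot_piE; rewrite quot_reprK.
Qed.

Definition quot_hom : hom A quotient := @Hom A quotient quot_pi quot_pi_hom.

Lemma satisfies_quotient q :
  satisfies quotient q <->
  forall h : hom (FmS nat) A,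
    (forall e, premises q e -> theta (h e.1, h e.2)) ->
    theta (h (conclusion q).1, h (conclusion q).2).
Proof.
split => H h hq.
  apply/quot_piE; apply: (H (hom_comp quot_hom h)) => e /hq.
  by move/quot_piE.
pose h' := eval_hom (fun x => quot_repr (h (Var x))).
have hE t : h t = quot_pi (h' t).
  rewrite (hom_FmE h) -[RHS]/(hom_comp quot_hom h' t) hom_FmE; congr eval.
  by apply/funext => x /=; rewrite quot_reprK.
rewrite /solves !hE; apply/quot_piE/H => e /hq.
by rewrite /solves !hE => /quot_piE.
Qed.

End Quotient.

Record Co (K : quasivariety) (A : structure) := MkCo {
  Co_rel :> set (A * A);
  Co_relP : `[< congruence Co_rel /\ K (quotient Co_rel) >] }.

End Structures.

Arguments Var {Sigma X} _.

HB.instance Definition _ Sigma K A := [isSub for @Co_rel Sigma K A].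
HB.instance Definition _ Sigma K A := [Choice of @Co Sigma K A by <:].
HB.instance Definition _ Sigma K A :=
  [SubChoice_isSubPOrder of @Co Sigma K A by <: with set_display].

Section CoLattice.
Variables (Sigma : signature) (K : quasivariety Sigma).
Implicit Types A B : structure Sigma.

Lemma Co_leE A (x y : Co K A) : (x <= y)%O = `[< Co_rel x `<=` Co_rel y >].
Proof. by rewrite -Order.le_val; apply/idP/asboolP; rewrite subsetEset. Qed.

Lemma Co_congruence A (x : Co K A) : congruence (Co_rel x).
Proof. by have /asboolP[] := Co_relP x. Qed.

Lemma in_CoP A : exists Q : set (quasi_identity Sigma),
  forall theta : set (A * A), congruence theta ->
  (K (quotient theta) <->
   forall q, Q q -> forall h : hom (FmS Sigma nat) A,
    (forall e, premises q e -> theta (h e.1, h e.2)) ->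
    theta (h (conclusion q).1, h (conclusion q).2)).
Proof.
have [Q QP] := qv_axiomatizable K; exists Q => theta thetaP.
rewrite QP; split => H q /H; first by move=> /(satisfies_quotient thetaP).
by move=> ?; apply/(satisfies_quotient thetaP).
Qed.

Lemma Co_inf_subproof A (S : set (Co K A)) :
  `[< congruence [set ab | forall x, S x -> Co_rel x ab] /\
      K (quotient [set ab | forall x, S x -> Co_rel x ab]) >].
Proof.
have [Q QP] := in_CoP A; apply/asboolP.
have cong : congruence [set ab | forall x, S x -> Co_rel x ab].
  split => [a|a b ab|a b c ab bc|f a b ab] x Sx;
    have [rfl sym trans comp] := Co_congruence x.
  - exact: rfl.
  - exact/sym/ab.
  - exact: trans (ab _ Sx) (bc _ Sx).
  - by apply: comp => j; exact: ab.
split=> //; apply/QP => // q Qq h hq x Sx.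
have /asboolP[cx /(QP _ cx) Kx] := Co_relP x.
by apply: Kx => // e /hq; exact.
Qed.

Definition Co_inf A (S : set (Co K A)) : Co K A := MkCo (Co_inf_subproof S).

Lemma Co_infP A (S : set (Co K A)) : infimums S (Co_inf S).
Proof.
split => [x Sx|y yS]; rewrite Co_leE; apply/asboolP => ab /=.
  exact.
by move=> yab x Sx; have := yS _ Sx; rewrite Co_leE => /asboolP; exact.
Qed.

Definition Co_sup A (S : set (Co K A)) : Co K A := Co_inf (ubound S).

Lemma Co_supP A (S : set (Co K A)) : supremums S (Co_sup S).
Proof.
have [H1 H2] := Co_infP (ubound S); split => [x Sx|y yS].
  by apply: H2 => y; exact.
exact: H1.
Qed.

Lemma directed_finite A (D : set (Co K A)) : directed D ->
  forall (T : Type) (F : set T) (g : T -> A * A), finite_set F ->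
  (forall e, F e -> exists2 x, D x & Co_rel x (g e)) ->
  exists2 x, D x & forall e, F e -> Co_rel x (g e).
Proof.
move=> [[x0 Dx0] Ddir] T F g Ffin.
have /(@finite_seqP {classic T})[s ->] : finite_set (F : set {classic T}) by [].
elim: s => [|e s IH] H; first by exists x0.
have [|x Dx xs] := IH.
  by move=> e' e's; apply: H; rewrite /= inE e's orbT.
have [|y Dy ye] := H e; first by rewrite /= inE eqxx.
have [z [Dz]] := Ddir _ _ Dx Dy.
rewrite !Co_leE => /asboolP xz /asboolP yz; exists z => // e'.
by rewrite /= inE => /orP[/eqP ->|e's]; [exact: yz|exact/xz/xs].
Qed.

Lemma Co_dirsup_subproof A (D : set (Co K A)) (dD : directed D) :
  `[< congruence [set ab | exists2 x, D x & Co_rel x ab] /\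
      K (quotient [set ab | exists2 x, D x & Co_rel x ab]) >].
Proof.
have [Q QP] := in_CoP A; apply/asboolP.
have cong : congruence [set ab | exists2 x, D x & Co_rel x ab].
  split => [a|a b [x Dx ab]|a b c [x Dx ab] [y Dy bc]|f a b ab].
  - by have [[x Dx] _] := dD; exists x => //; case: (Co_congruence x).
  - by exists x => //; have [_ sym _ _] := Co_congruence x; exact: sym.
  - have [z [Dz]] := dD.2 _ _ Dx Dy.
    rewrite !Co_leE => /asboolP xz /asboolP yz; exists z => //.
    by have [_ _ trans _] := Co_congruence z; apply: trans (xz _ ab) (yz _ bc).
  - have [||x Dx xab] := @directed_finite _ _ dD 'I_(arity f) setT
      (fun j => (a j, b j)).
    + exact: finite_finset.
    + by move=> j _; exact: ab.
    exists x => //; have [_ _ _ comp] := Co_congruence x.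
    by apply: comp => j; exact: xab.
split=> //; apply/QP => // q Qq h hq.
have [x Dx xq] := @directed_finite _ _ dD _ (premises q)
  (fun e => (h e.1, h e.2)) (premises_finite q) hq.
exists x => //; have /asboolP[cx /(QP _ cx) Kx] := Co_relP x.
exact: Kx.
Qed.

Lemma Co_dirsupE A (D : set (Co K A)) s : directed D -> supremums D s ->
  Co_rel s = [set ab | exists2 x, D x & Co_rel x ab].
Proof.
move=> dD [s_ub s_lub]; apply/seteqP; split => [ab sab|ab [x /s_ub]].
  have := s_lub (MkCo (Co_dirsup_subproof dD)).
  rewrite Co_leE => /(_ _)/asboolP; apply => // x Dx.
  by rewrite Co_leE; apply/asboolP => cd xcd; exists x.
by rewrite Co_leE => /asboolP; exact.
Qed.

Lemma Co_compactly_generated A (x : Co K A) :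
  supremums [set c | compact_elt c /\ (c <= x)%O] x.
Proof.
split => [c []//|y y_ub]; rewrite Co_leE; apply/asboolP => ab xab.
pose c := Co_inf [set z : Co K A | Co_rel z ab].
have c_le z : Co_rel z ab -> (c <= z)%O.
  by have [lb _] := Co_infP [set z : Co K A | Co_rel z ab]; exact: lb.
have cab : Co_rel c ab by move=> z.
have : (c <= y)%O.
  apply: y_ub; split; last exact: c_le.
  move=> D s dD Ds; rewrite Co_leE => /asboolP /(_ _ cab).
  by rewrite (Co_dirsupE dD Ds) => -[z Dz /c_le]; exists z.
by rewrite Co_leE => /asboolP; exact.
Qed.

HB.instance Definition _ A :=
  isAlgebraicLattice.Build set_display (Co K A)
    (fun S => ex_intro _ _ (Co_infP S)) (fun S => ex_intro _ _ (Co_supP S))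
    (@Co_compactly_generated A).

Lemma Co_map_subproof A B (h : hom A B) (y : Co K B) :
  `[< congruence [set ab | Co_rel y (h ab.1, h ab.2)] /\
      K (quotient [set ab | Co_rel y (h ab.1, h ab.2)]) >].
Proof.
have /asboolP[cy Ky] := Co_relP y; have [rfl sym trans comp] := cy.
apply/asboolP.
have cong : congruence [set ab | Co_rel y (h ab.1, h ab.2)].
  split => /= [a|a b|a b c|f a b ab].
  - exact: rfl.
  - exact: sym.
  - exact: trans.
  - by rewrite !homP; exact: comp.
split=> //; have [Q QP] := qv_axiomatizable K; apply/QP => q Qq.
apply/satisfies_quotient => // g gq /=.
have /(satisfies_quotient cy)/(_ (hom_comp h g)) := (QP _).1 Ky _ Qq.
exact.
Qed.

Definition Co_map A B (h : hom A B) (y : Co K B) : Co K A :=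
  MkCo (Co_map_subproof h y).

End CoLattice.

Section FilterPairs.
Variable Sigma : signature.

(* The display [d] is only a notational tag of the library order structures. *)
Record al_functor (d : Order.disp_t) := AlFunctor {
  fobj :> structure Sigma -> algLatticeType d;
  fmap : forall A B, hom A B -> fobj B -> fobj A;
  fmap_inf : forall A B (h : hom A B), preserves_infima (fmap h);
  fmap_sup : forall A B (h : hom A B), preserves_directed_suprema (fmap h);
  fmap_id : forall A (x : fobj A), fmap (hom_id A) x = x;
  fmap_comp : forall A B C (g : hom B C) (h : hom A B) (x : fobj C),
    fmap (hom_comp g h) x = fmap h (fmap g x) }.

(* [set A] carries the library order by inclusion, so [fp_inf] and [fp_sup] say
   that infima go to intersections and directed suprema to unions. *)
Record filter_pair d (G : al_functor d)
    (i : forall A : structure Sigma, G A -> set A) : Prop := FilterPair {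
  fp_inf : forall A, preserves_infima (i A);
  fp_sup : forall A, preserves_directed_suprema (i A);
  fp_natural : forall A B (h : hom A B) (b : G B),
    i A (fmap h b) = h @^-1` (i B b) }.

Definition associated_logic d (G : al_functor d)
    (i : forall A : structure Sigma, G A -> set A) (X : Type)
    (Gamma : set (Fm Sigma X)) (phi : Fm Sigma X) :=
  forall a : G (FmS Sigma X), Gamma `<=` i (FmS Sigma X) a ->
    i (FmS Sigma X) a phi.

End FilterPairs.

Arguments filter_pair {Sigma d} G i.
Arguments associated_logic {Sigma d} G i X Gamma phi.

Section CoFunctor.
Variables (Sigma : signature) (K : quasivariety Sigma).
Implicit Types A B C : structure Sigma.

Lemma Co_map_inf A B (h : hom A B) : preserves_infima (@Co_map _ K _ _ h).
Proof.
move=> S m Sm; have -> : m = Co_inf S.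
  exact: (is_subset1_infimums Sm (Co_infP S)).
split => [_ [x Sx <-]|y yS]; rewrite Co_leE; apply/asboolP => ab /=.
  by apply.
move=> yab x Sx.
by have := yS _ (imageP _ Sx); rewrite Co_leE => /asboolP /(_ _ yab).
Qed.

Lemma Co_map_sup A B (h : hom A B) :
  preserves_directed_suprema (@Co_map _ K _ _ h).
Proof.
move=> D s dD Ds; split => [_ [x Dx <-]|y yD]; rewrite Co_leE;
  apply/asboolP => ab /=.
  by move=> xab; rewrite (Co_dirsupE dD Ds); exists x.
rewrite (Co_dirsupE dD Ds) => -[x Dx xab].
by have := yD _ (imageP _ Dx); rewrite Co_leE => /asboolP; exact.
Qed.

Lemma Co_map_id A (x : Co K A) : Co_map (hom_id A) x = x.
Proof. by apply/val_inj/seteqP; split => -[a b]. Qed.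

Lemma Co_map_comp A B C (g : hom B C) (h : hom A B) (x : Co K C) :
  Co_map (hom_comp g h) x = Co_map h (Co_map g x).
Proof. exact/val_inj. Qed.

Definition Co_functor : al_functor Sigma set_display :=
  @AlFunctor Sigma set_display (fun A => Co K A) (@Co_map Sigma K)
    Co_map_inf Co_map_sup Co_map_id Co_map_comp.

End CoFunctor.

Section Algebraizable.
Variables (Sigma : signature) (X : Type).
Local Notation Fm := (Fm Sigma).

(* Formulas in one, resp. two, variables are elements of [Fm unit], resp.
   [Fm bool], with [p := Var true] and [q := Var false]. If [X] has at least
   two elements this is the same as fixing distinct [p, q : X] and taking
   formulas of [Fm X] in which no other variables occur. *)
Definition inst1 (t : Fm unit) (phi : Fm X) : Fm X := subst (fun=> phi) t.

Definition inst2 (t : Fm bool) (phi psi : Fm X) : Fm X :=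
  subst (fun b => if b then phi else psi) t.

Definition tau_image (tau : set (equation Sigma unit)) (Gamma : set (Fm X)) :
    set (equation Sigma X) :=
  [set (inst1 e.1 gamma, inst1 e.2 gamma) | e in tau & gamma in Gamma].

Definition Delta_image (Delta : set (Fm bool)) (E : set (equation Sigma X)) :
    set (Fm X) :=
  [set inst2 t e.1 e.2 | t in Delta & e in E].

Definition entails_all (entails : set (Fm X) -> Fm X -> Prop)
    (Gamma Gamma' : set (Fm X)) :=
  forall phi, Gamma' phi -> entails Gamma phi.

Definition algebraizable (entails : set (Fm X) -> Fm X -> Prop) :=
  exists (K' : structure Sigma -> Prop) (tau : set (equation Sigma unit))
         (Delta : set (Fm bool)),
  [/\ finite_set Delta,
      forall (Gamma : set (Fm X)) (phi : Fm X),
        entails Gamma phi <->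
        forall e, tau_image tau [set phi] e ->
          models K' (tau_image tau Gamma) e,
      forall (E : set (equation Sigma X)) (phi psi : Fm X),
        models K' E (phi, psi) <->
        entails_all entails (Delta_image Delta E)
          (Delta_image Delta [set (phi, psi)])
    & forall psi : Fm X,
        let Psi := Delta_image Delta (tau_image tau [set psi]) in
        entails_all entails [set psi] Psi /\ entails Psi psi].

End Algebraizable.

(* Main.v *)
(** Naturality of [i] along [Fm(x) -> A, x |-> a] shows that membership of [a]
    in [i_A theta] says that [theta] contains the instance at [a] of the least
    [K]-congruence [tau] of [Fm(x)] with [x \in i tau]. Being injective and
    meet-preserving, [i_Fm(X)] is an order embedding, so the [K]-congruence
    generated by [(p, q)] is the least [theta] with
    [i (Cg (p, q)) `<=` i theta]; as it is compact, finitely many formulas of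
    [i (Cg (p, q))] suffice, and these, read as formulas in [p] and [q], form
    [Delta]. *)
Require Import Defs.
From mathcomp Require Import all_boot all_order.
From mathcomp Require Import boolp classical_sets functions cardinality.

Set Implicit Arguments.
Unset Strict Implicit.
Unset Printing Implicit Defensive.
Import Order.TTheory.
Local Open Scope classical_set_scope.

Lemma Co_le Sigma (K : quasivariety Sigma) (A : structure Sigma)
    (x y : Co K A) : (x <= y)%O <-> Co_rel x `<=` Co_rel y.
Proof. by rewrite Co_leE; split => /asboolP. Qed.

Lemma Co_inf_le Sigma (K : quasivariety Sigma) (A : structure Sigma)
    (S : set (Co K A)) (x : Co K A) : S x -> (Co_inf S <= x)%O.
Proof. by move=> Sx; apply/Co_le => ab; exact. Qed.

Lemma hom_eval Sigma X (A B : structure Sigma) (h : hom A B) (v : X -> A) t :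
  h (eval v t) = eval (fun x => h (v x)) t.
Proof. by rewrite -[LHS]/(hom_comp h (eval_hom v) t) hom_FmE. Qed.

Section Models.
Variables (Sigma : signature) (K : quasivariety Sigma).

Lemma Co_diag_subproof (A : structure Sigma) (KA : K A) :
  `[< congruence [set ab : A * A | ab.1 = ab.2] /\
      K (quotient [set ab : A * A | ab.1 = ab.2]) >].
Proof.
have cong : congruence [set ab : A * A | ab.1 = ab.2].
  split=> //= [a b c -> //|f a b ab]; congr interp; exact/funext.
apply/asboolP; split=> //.
have [Q QP] := qv_axiomatizable K; apply/QP => q Qq.
by apply/(satisfies_quotient cong); exact: (QP A).1 Qq.
Qed.

Definition Co_diag (A : structure Sigma) (KA : K A) : Co K A :=
  MkCo (Co_diag_subproof KA).

(** Each [x] is the kernel of its quotient map, whose target lies in [K]; conversely, the kernel of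
    a homomorphism into a member of [K] is the pullback of [Co_diag]. *)
Lemma modelsP X (E : set (equation Sigma X)) e :
  models K E e <->
  forall x : Co K (FmS Sigma X), E `<=` Co_rel x -> Co_rel x e.
Proof.
split=> [H x Ex|H A KA h hE].
  have /asboolP[cx Kx] := Co_relP x; case: e H => a b H.
  apply/(quot_piE cx); apply: (H _ Kx (quot_hom cx)) => -[c d] /Ex.
  by move/(quot_piE cx).
by apply: (H (Co_map h (Co_diag KA))) => e' /hE.
Qed.

End Models.

Section FilterPair.
Variables (Sigma : signature) (K : quasivariety Sigma).
Variable i : forall A : structure Sigma, Co_functor K A -> set A.
Hypothesis iP : filter_pair (Co_functor K) i.

Lemma fp_Co_inf (A : structure Sigma) (S : set (Co K A)) a :
  i (Co_inf S : Co_functor K A) a <->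
  forall x, S x -> i (x : Co_functor K A) a.
Proof.
have [lb glb] := fp_inf iP (Co_infP S : infimums (S : set (Co_functor K A)) _).
split=> [iSa x Sx|ixa].
  by have := lb _ (imageP _ Sx); rewrite subsetEset; apply.
(* Membership of [a] is expressed as the singleton of [a] being a lower bound. *)
have := glb [set a]; rewrite subsetEset => /(_ _ a); apply=> //.
by move=> _ [x Sx <-]; rewrite subsetEset => _ ->; exact: ixa.
Qed.

(** If [x <= y] then [x] is the meet of [x] and [y], which [i] sends to an intersection. *)
Lemma fp_mono (A : structure Sigma) (x y : Co K A) : (x <= y)%O ->
  i (x : Co_functor K A) `<=` i (y : Co_functor K A).
Proof.
move=> xy a ixa.
suff : i (Co_inf [set x; y] : Co_functor K A) a.
  by move/fp_Co_inf; apply; right.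
have -> // : Co_inf [set x; y] = x.
apply/le_anti/andP; split; first by apply: Co_inf_le; left.
by apply/Co_le => ab xab _ [->//|->]; exact: (Co_le x y).1 xy _ xab.
Qed.

(** The meet of [x] and [y] has the same image as [x], hence equals [x] by injectivity. *)
Lemma fp_embedding (A : structure Sigma) (x y : Co K A) :
  injective (@i A) ->
  i (x : Co_functor K A) `<=` i (y : Co_functor K A) -> (x <= y)%O.
Proof.
move=> i_inj xy; have <- : Co_inf [set x; y] = x.
  apply: i_inj; apply/seteqP; split=> a.
    by move/fp_Co_inf; apply; left.
  by move=> ixa; apply/fp_Co_inf => _ [->//|->]; exact: xy.
by apply: Co_inf_le; right.
Qed.

Definition fp_tau : Co K (FmS Sigma unit) :=
  Co_inf [set x : Co K (FmS Sigma unit) |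
    i (x : Co_functor K (FmS Sigma unit)) (Var tt)].

Lemma fp_tauP (A : structure Sigma) (x : Co K A) a :
  i (x : Co_functor K A) a <->
  forall e, Co_rel fp_tau e ->
    Co_rel x (eval (fun=> a) e.1, eval (fun=> a) e.2).
Proof.
pose h := @eval_hom Sigma unit A (fun=> a).
have -> : i (x : Co_functor K A) a =
    i (Co_map h x : Co_functor K (FmS Sigma unit)) (Var tt).
  by rewrite (fp_natural iP h x).
split=> [ix|tx]; first by apply/(Co_le fp_tau (Co_map h x)); exact: Co_inf_le.
(* As [i] preserves infima, [i fp_tau] contains the variable; monotonicity carries it up to the
   pullback of [x]. *)
by apply: (@fp_mono _ fp_tau); [exact/Co_le|apply/fp_Co_inf].
Qed.

Lemma subset_fpP X (Gamma : set (Fm Sigma X)) (x : Co K (FmS Sigma X)) :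
  Gamma `<=` i (x : Co_functor K (FmS Sigma X)) <->
  tau_image (Co_rel fp_tau) Gamma `<=` Co_rel x.
Proof.
split=> [Gx _ [e te [g Gg <-]]|Gx g Gg].
  exact: (fp_tauP _ _).1 (Gx g Gg) e te.
by apply/fp_tauP => e te; apply: Gx; exists e => //; exists g.
Qed.

Lemma fp_finite_generation (A : structure Sigma) (p q : A) :
  injective (@i A) ->
  exists2 F : set A, finite_set F &
    forall x : Co K A, F `<=` i (x : Co_functor K A) <-> Co_rel x (p, q).
Proof.
move=> i_inj; pose c := Co_inf [set x : Co K A | Co_rel x (p, q)].
pose Gamma := i (c : Co_functor K A).
pose cg F := Co_inf [set x : Co K A | F `<=` i (x : Co_functor K A)].
have cg_mono F F' : F `<=` F' -> (cg F <= cg F')%O.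
  by move=> FF'; apply/Co_le => ab abF x xF'; apply: abF; exact: subset_trans xF'.
(* [Gamma] is approximated by its finite subsets, closed under finite unions; this makes [D]
   directed. *)
pose D := [set cg F | F in [set F | finite_set F /\ F `<=` Gamma]].
have dD : directed D.
  split; first by exists (cg set0); exists set0 => //; split=> //; exact: sub0set.
  move=> _ _ [F [Ff FG] <-] [F' [F'f F'G] <-]; exists (cg (F `|` F')).
  split; [|exact/cg_mono/subsetUl|exact/cg_mono/subsetUr].
  by exists (F `|` F') => //; split; [rewrite finite_setU|rewrite subUset].
have sD := Co_supP D.
have : Co_rel (Co_sup D) (p, q).
  have cpq : Co_rel c (p, q) by move=> x.
  (* Each [g] in [Gamma] lies in [i (cg [set g])], so [i c] is included in [i (Co_sup D)]. *)
  apply: (Co_le c (Co_sup D)).1 _ cpq; apply: fp_embedding => // g Gg.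
  apply: (@fp_mono _ (cg [set g])); last by apply/fp_Co_inf => x; exact.
  apply: sD.1; exists [set g] => //; split; first exact: finite_set1.
  by move=> _ ->.
(* A directed supremum of congruences is their union, so a single [cg F] contains the pair. *)
rewrite (Co_dirsupE dD sD) => -[_ [F [Ff FG] <-] Fpq].
exists F => // x; split=> [Fx|xpq]; first exact: Fpq.
by apply: subset_trans FG _; apply: fp_mono; exact: Co_inf_le.
Qed.

Lemma fp_Delta X : (exists p q : X, p <> q) -> injective (@i (FmS Sigma X)) ->
  exists2 Delta : set (Fm Sigma bool), finite_set Delta &
    forall (E : set (equation Sigma X)) (x : Co K (FmS Sigma X)),
      Delta_image Delta E `<=` i (x : Co_functor K (FmS Sigma X)) <->
      E `<=` Co_rel x.
Proof.
move=> [p [q pq]] i_inj.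
have [F Ff FP] := @fp_finite_generation (FmS Sigma X) (Var p) (Var q) i_inj.
(* [F] may contain variables other than [p] and [q]; they are all identified with [p]. *)
pose s (y : X) : FmS Sigma bool := Var `[< y <> q >].
exists (eval s @` F) => [|E x]; first exact: finite_image.
pose h (e : equation Sigma X) : hom (FmS Sigma X) (FmS Sigma X) :=
  @eval_hom Sigma X (FmS Sigma X) (fun y => if `[< y <> q >] then e.1 else e.2).
have hE e t : inst2 (eval s t) e.1 e.2 = h e t.
  rewrite /inst2 /subst.
  exact: (hom_eval (@eval_hom Sigma bool (FmS Sigma X)
    (fun b => if b then e.1 else e.2)) s t).
(* [h e] sends [Var p] to [e.1] and [Var q] to [e.2], so the pullback of [x] contains this pair of
   variables exactly when [x] contains [e]. *)
have key e : F `<=` i (Co_map (h e) x : Co_functor K (FmS Sigma X)) <->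
    Co_rel x e.
  rewrite FP /= asboolT // asboolF; last by move=> /(_ erefl).
  by rewrite -surjective_pairing.
split=> [DE e Ee|Ex _ [_ [t Ft <-] [e Ee <-]]].
  apply/key => t Ft; rewrite (fp_natural iP (h e) x) /preimage /mkset -hE.
  by apply: DE; exists (eval s t); [exists t|exists e].
rewrite hE; have /key/(_ t Ft) := Ex e Ee.
by rewrite (fp_natural iP (h e) x).
Qed.

End FilterPair.

Theorem proposition3p7 (Sigma : signature) (K : quasivariety Sigma) (X : Type)
    (two_variables : exists p q : X, p <> q)
    (i : forall A : structure Sigma, Co_functor K A -> set A)
    (Hi : filter_pair (Co_functor K) i)
    (i_inj : injective (i (FmS Sigma X))) :
  algebraizable (associated_logic (Co_functor K) i X).
Proof.
have [Delta Df DP] := fp_Delta Hi two_variables i_inj.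
(* By [modelsP], both consequence relations quantify over the [K]-congruences [x] of the formula
   algebra, and [fp_tau] and [Delta] translate the conditions on [x]. *)
exists K, (Co_rel (fp_tau i)), Delta; split=> //.
- move=> Gamma phi; split=> [H e phie|H x /(subset_fpP Hi) Gx].
    apply/modelsP => x /(subset_fpP Hi)/H ix.
    have : [set phi] `<=` i (FmS Sigma X) x by move=> _ ->.
    by move/(subset_fpP Hi); exact.
  suff : [set phi] `<=` i (FmS Sigma X) x by exact.
  by apply/(subset_fpP Hi) => e /H/modelsP; exact.
- move=> E phi psi; rewrite modelsP; split=> [H t Dt x /DP Ex|H x Ex].
    suff : [set (phi, psi)] `<=` Co_rel x by move/DP; exact.
    by move=> _ ->; exact: H.
  have /DP : Delta_image Delta [set (phi, psi)] `<=` i (FmS Sigma X) x.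
    by move=> t /H; apply; apply/DP.
  exact.
- move=> psi Psi; split=> [t Pt x /(subset_fpP Hi)/DP|x /DP/(subset_fpP Hi)]; exact.
Qed.
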